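(* Let $n\ge 3$ be odd and put $M=(n-1)^{n-1}$. Suppose that for every integer $x\ge 1$ $$\sum_{j=0}^{\frac{n-1}{2}}(-1)^j\binom{n}{2j+1}S_{n,0}\big((n-1)^{2j}x\big)=\sum_{j=0}^{n-1}S_{n,j}(x).$$ Define, for integers $x\ge 0$, $\nu_n(x)$ by $$S_{n,0}(x)=\sum_{j=0}^{\frac{n-3}{2}}(-1)^{\frac{n-3}{2}-j}\binom{n}{2j+1}S_{n,0}\Big((n-1)^{2j}\Big\lfloor\frac{x}{M}\Big\rfloor\Big)+\nu_n(x).$$ Then the sequence $\big((-1)^{s_{n-1}(x)}\nu_n(x)\big)_{x\ge 0}$ is periodic with period $2n(n-1)^{n-1}$.
   Context: For an integer $b\ge 2$ and integer $r\ge 0$, $s_b(r)$ denotes the sum of the digits of $r$ in base $b$. For integers $n\ge 3$, $0\le j\le n-1$ and $x\ge 0$, define $$S_{n,j}(x)=\sum_{0\le r<x,\; r\equiv j \pmod n}(-1)^{s_{n-1}(r)}.$$ *)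

(* Defs.v *)
From mathcomp Require Export all_boot all_order all_algebra.

Set Implicit Arguments.
Unset Strict Implicit.
Unset Printing Implicit Defensive.

Import GRing.Theory.
Local Open Scope ring_scope.

(* The digit of r at position i is (r %/ b ^ i) %% b; for 2 <= b it vanishes
   at every position i >= r, because r < b ^ r. *)
Definition digit_sum (b r : nat) : nat :=
  (\sum_(0 <= i < r) (r %/ b ^ i) %% b)%N.

Definition S_sum (n j x : nat) : int :=
  \sum_(0 <= r < x | r == j %[mod n]) (-1) ^+ digit_sum (n - 1) r.

(* Main.v *)
Require Import Defs.
From mathcomp Require Import all_boot all_order all_algebra.
From mathcomp Require Import zify ring.

Set Implicit Arguments.
Unset Strict Implicit.
Unset Printing Implicit Defensive.

Import GRing.Theory.
Local Open Scope ring_scope.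

(** Write [b = n - 1], [e(r) = (-1)^(s_b(r))] and [x = M q + t] with [t < M].
    Then [e(M q + u) = e(q) e(u)] for [u < M], and [M = 1] modulo [n], so
    [S_{n,0}(x) - S_{n,0}(M q) = e(q) g(q, t)], where [g] depends on [q] only
    modulo [n].  The hypothesis at [q], solved for its top term [S_{n,0}(M q)],
    turns this into [nu(x) = (-1)^((n-1)/2) E(q) + e(q) g(q, t)] with
    [E(q) = sum_(r < q) e(r)].  Since [b] is even, [e(2k) + e(2k+1) = 0], so
    [e(q) E(q)] depends only on the parity of [q]; hence [e(x) nu(x)] is
    periodic in [q] with period [2n]. *)

(** Frees the range from [r], so that digit sums of different numbers can be compared position by
    position. *)
Lemma digit_sum_trunc (b r N : nat) : (1 < b)%N -> (r <= N)%N ->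
  digit_sum b r = (\sum_(0 <= i < N) (r %/ b ^ i) %% b)%N.
Proof.
move=> b_gt1 rN; rewrite /digit_sum [RHS](big_cat_nat (n := r)) //=.
rewrite -[LHS]addn0; congr (_ + _)%N; rewrite big_nat_cond big1 // => i.
rewrite andbT => /andP[ri _].
by rewrite divn_small ?mod0n // (leq_ltn_trans ri) // ltn_expl.
Qed.

Lemma digit_sum_mulD (b q d : nat) : (1 < b)%N -> (d < b)%N ->
  digit_sum b (b * q + d) = (digit_sum b q + d)%N.
Proof.
move=> b_gt1 db; have b_gt0 : (0 < b)%N by lia.
(* The left range is one longer, so that the two ranges agree once position 0, which holds [d], is
   split off. *)
rewrite (@digit_sum_trunc b (b * q + d) (b * q + d).+1) //.
rewrite (@digit_sum_trunc b q (b * q + d)) //; last by nia.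
rewrite big_nat_recl // expn0 divn1 mulnC modnMDl modn_small // addnC.
congr (_ + _)%N; apply: eq_bigr => i _.
by rewrite expnS divnMA divnMDl // (divn_small db) addn0.
Qed.

(** The base-[b] digits of [t] fill the lowest [k] positions without touching those of [q]; the
    induction peels off the last digit of [t]. *)
Lemma digit_sum_expD (b k q t : nat) : (1 < b)%N -> (t < b ^ k)%N ->
  digit_sum b (b ^ k * q + t) = (digit_sum b q + digit_sum b t)%N.
Proof.
move=> b_gt1; have b_gt0 : (0 < b)%N by lia.
elim: k t => [|k IHk] t tlt.
  have -> : t = 0%N by move: tlt; rewrite expn0; case: t.
  by rewrite expn0 mul1n addn0 {3}/digit_sum big_geq ?addn0.
have tb : (t %/ b < b ^ k)%N by rewrite ltn_divLR // -expnSr.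
have tE : t = (b * (t %/ b) + t %% b)%N by rewrite mulnC -divn_eq.
rewrite [in LHS]tE expnS -mulnA addnA -mulnDr digit_sum_mulD ?ltn_mod //.
by rewrite IHk // [in RHS]tE digit_sum_mulD ?ltn_mod // addnA.
Qed.

Definition digit_sign (b r : nat) : int := (-1) ^+ digit_sum b r.

Lemma digit_sign_sqr (b r : nat) : digit_sign b r * digit_sign b r = 1.
Proof. by rewrite -expr2 sqrr_sign. Qed.

Lemma digit_sign_expD (b k q t : nat) : (1 < b)%N -> (t < b ^ k)%N ->
  digit_sign b (b ^ k * q + t) = digit_sign b q * digit_sign b t.
Proof. by move=> b_gt1 tlt; rewrite /digit_sign digit_sum_expD // exprD. Qed.

(** With [b] and [r] even, the last digit of [r] is even, hence below [b - 1]: adding 1 causes no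
    carry. *)
Lemma digit_signS (b r : nat) : (1 < b)%N -> ~~ odd b -> ~~ odd r ->
  digit_sign b r.+1 = - digit_sign b r.
Proof.
move=> b_gt1 b_even r_even; have b_gt0 : (0 < b)%N by lia.
have rE : r = (b * (r %/ b) + r %% b)%N by rewrite mulnC -divn_eq.
have rb : (r %% b < b)%N by rewrite ltn_mod.
have rSb : ((r %% b).+1 < b)%N.
  have : ~~ odd (r %% b).
    by move: r_even; rewrite {1}rE oddD oddM (negbTE b_even).
  by lia.
rewrite /digit_sign [in LHS]rE -addnS digit_sum_mulD //.
by rewrite [in RHS]rE digit_sum_mulD // addnS exprS mulN1r.
Qed.

(** Terms [2k] and [2k+1] cancel, so for odd [q] only the term at [q - 1] survives. It is written
    through the sign at [q] so that multiplying by that sign leaves only the parity of [q]. *)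
Lemma sum_digit_sign (b q : nat) : (1 < b)%N -> ~~ odd b ->
  \sum_(0 <= r < q) digit_sign b r = - digit_sign b q *+ odd q.
Proof.
move=> b_gt1 b_even; elim: q => [|q IHq]; first by rewrite big_geq.
rewrite big_nat_recr //= IHq; case q_odd: (odd q) => /=.
  by rewrite mulr1n mulr0n addNr.
by rewrite digit_signS ?q_odd // mulr0n mulr1n add0r opprK.
Qed.

Lemma S_sum0 (n j : nat) : S_sum n j 0 = 0.
Proof. by rewrite /S_sum big_geq. Qed.

Lemma sum_S_sum (n x : nat) : (0 < n)%N ->
  \sum_(0 <= j < n) S_sum n j x = \sum_(0 <= r < x) digit_sign (n - 1) r.
Proof.
move=> n_gt0; rewrite /S_sum; under eq_bigr do rewrite big_mkcond.
rewrite exchange_big; apply: eq_bigr => r _; rewrite big_mkord.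
rewrite (bigD1 (Ordinal (ltn_pmod r n_gt0))) //= modn_mod eqxx big1 ?addr0 //.
move=> j /eqP j_neq; case: eqP => // rj; case: j_neq; apply: val_inj => /=.
by rewrite rj modn_small.
Qed.

(** [n - 1] is -1 modulo [n], and the exponent [n - 1] is even. *)
Lemma predn_exp_modn (n : nat) : (0 < n)%N -> odd n ->
  ((n - 1) ^ (n - 1) = 1 %[mod n])%N.
Proof.
move=> n_gt0 n_odd.
have -> : ((n - 1) ^ (n - 1) = ((n - 1) ^ 2) ^ (n %/ 2))%N.
  by rewrite -expnM; congr (_ ^ _)%N; lia.
rewrite -modnXm; have -> : ((n - 1) ^ 2 = 1 %[mod n])%N.
  case: n n_gt0 {n_odd} => // [[|n]] _ //.
  by rewrite (_ : (n.+2 - 1) ^ 2 = n * n.+2 + 1)%N ?modnMDl //; nia.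
by rewrite modnXm exp1n.
Qed.

Lemma S_sum_block (n q t : nat) : (3 <= n)%N -> odd n ->
  (t <= (n - 1) ^ (n - 1))%N ->
  S_sum n 0 ((n - 1) ^ (n - 1) * q + t) =
  S_sum n 0 ((n - 1) ^ (n - 1) * q) +
  digit_sign (n - 1) q *
    \sum_(0 <= u < t | q + u == 0 %[mod n]) digit_sign (n - 1) u.
Proof.
move=> n_ge3 n_odd; set M := ((n - 1) ^ (n - 1))%N => tM.
rewrite {1}/S_sum (big_cat_nat (n := (M * q)%N)) ?leq_addr //=.
congr (_ + _); rewrite -{1}[(M * q)%N]add0n big_addn addKn.
rewrite big_distrr /= [LHS]big_nat_cond [RHS]big_nat_cond.
apply: eq_big => [u|u /andP[/andP[_ ut] _]].
  have Mn : (M = 1 %[mod n])%N by apply: predn_exp_modn => //; lia.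
  by rewrite (addnC u) -(modnDml (M * q)) -modnMml Mn modnMml mul1n modnDml.
rewrite addnC -/(digit_sign _ _) digit_sign_expD //; first by lia.
exact: leq_trans tM.
Qed.

Theorem theorem8 (n : nat) (n_ge3 : (3 <= n)%N) (n_odd : odd n)
    (hS : forall x : nat, (1 <= x)%N ->
      \sum_(0 <= j < ((n - 1) %/ 2).+1)
         (-1) ^+ j * 'C(n, 2 * j + 1)%:Z * S_sum n 0 ((n - 1) ^ (2 * j) * x)%N
      = \sum_(0 <= j < n) S_sum n j x)
    (nu : nat -> int)
    (hnu : forall x : nat,
      S_sum n 0 x =
        \sum_(0 <= j < ((n - 3) %/ 2).+1)
           (-1) ^+ ((n - 3) %/ 2 - j) * 'C(n, 2 * j + 1)%:Z
             * S_sum n 0 ((n - 1) ^ (2 * j) * (x %/ (n - 1) ^ (n - 1)))%N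
        + nu x) :
  forall x : nat,
    (-1) ^+ digit_sum (n - 1) (x + 2 * n * (n - 1) ^ (n - 1))
      * nu (x + 2 * n * (n - 1) ^ (n - 1))%N
    = (-1) ^+ digit_sum (n - 1) x * nu x.
Proof.
have b_gt1 : (1 < n - 1)%N by lia.
have b_even : ~~ odd (n - 1) by lia.
set M := ((n - 1) ^ (n - 1))%N in hnu *.
have M_gt0 : (0 < M)%N by rewrite expn_gt0; lia.
pose m := ((n - 1) %/ 2)%N.
have mE : ((n - 3) %/ 2).+1 = m by rewrite /m; lia.
have topS q : S_sum n 0 (M * q) =
    \sum_(0 <= j < m) (-1) ^+ ((n - 3) %/ 2 - j) * 'C(n, 2 * j + 1)%:Z
        * S_sum n 0 ((n - 1) ^ (2 * j) * q)%N
    + (-1) ^+ m * \sum_(0 <= r < q) digit_sign (n - 1) r.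
  (* The hypothesis [hS] starts at 1; at [q = 0] both sides vanish. *)
  case: q => [|q].
    rewrite muln0 S_sum0 (big_geq (leqnn 0)) mulr0 addr0 big1 // => j _.
    by rewrite muln0 S_sum0 mulr0.
  have /esym := hS q.+1 isT; rewrite sum_S_sum; last by lia.
  (* The top term [j = m] of [hS] has coefficient [(-1) ^+ m] and argument [M * q], since
     [2 * m = n - 1]. *)
  move=> ->; rewrite -/m big_nat_recr //=.
  have -> : (2 * m + 1)%N = n by rewrite /m; lia.
  have -> : (2 * m)%N = (n - 1)%N by rewrite /m; lia.
  rewrite binn mulr1 mulrDr mulrA -expr2 sqrr_sign mul1r addrA.
  rewrite big_distrr -big_split /= big_nat_cond big1 ?add0r // => j.
  rewrite andbT => /andP[_ jm].
  (* As [m] is one more than [(n - 3) %/ 2], each lower term returns with the opposite sign and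
     cancels. *)
  have -> : (-1) ^+ m = - ((-1) ^+ ((n - 3) %/ 2 - j) * (-1) ^+ j) :> int.
    have jm' : (j <= (n - 3) %/ 2)%N by rewrite -ltnS mE.
    by rewrite -mE exprS mulN1r -exprD subnK.
  set s := (-1) ^+ j; have s2 : s * s = 1 by rewrite -expr2 sqrr_sign.
  by rewrite !mulNr !mulrA -[_ * s * s]mulrA s2 mulr1 subrr.
(* On the right, [q] enters only through its parity and its residue modulo [n], whence the period
   [2 * n] in [q]. *)
have nuE q t : (t < M)%N ->
    digit_sign (n - 1) (M * q + t) * nu (M * q + t)%N =
    digit_sign (n - 1) t * ((-1) ^+ m * - (odd q)%:R
      + \sum_(0 <= u < t | q + u == 0 %[mod n]) digit_sign (n - 1) u).
  move=> tM; have := hnu (M * q + t)%N.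
  rewrite S_sum_block // 1?ltnW // -/M topS mulnC divnMDl //.
  (* The sum over [j] defining [nu] is the one in [topS], so it cancels. *)
  rewrite (divn_small tM) addn0 mE -addrA => /addrI <-.
  rewrite sum_digit_sign // mulnC digit_sign_expD //.
  have := digit_sign_sqr (n - 1) q; set e := digit_sign _ q => e2.
  rewrite -[in LHS]mulr_natr; set g := \sum_(_ <= _ < _ | _) _.
  set f := digit_sign _ t; set s := (-1) ^+ m; set o := _%:R.
  rewrite [LHS](_ : _ = (e * e) * (f * (s * - o + g))); last by ring.
  by rewrite e2 mul1r.
move=> x; rewrite -!/(digit_sign _ _) (divn_eq x M).
set q := (x %/ M)%N; set t := (x %% M)%N.
have tM : (t < M)%N by rewrite ltn_mod.
(* The shift by [2 * n * M] replaces [q] by [q + 2 * n] and keeps [t]. *)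
rewrite addnAC -mulnDl ![(_ * M)%N]mulnC !nuE // oddD mul2n odd_double addbF.
congr (_ * (_ + _)); apply: eq_bigl => u.
by rewrite -mul2n addnAC -modnDmr modnMl addn0.
Qed.
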